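(* Let $4\le k<n$ be integers such that $\gcd(n,k)=1$. Let $S=\{r^{a_1}s,\dots,r^{a_k}s\}\subseteq D_{2n}$ be a set of $k$ distinct reflections, with $a_1,\dots,a_k\in\mathbb{Z}_n$, and let $\Delta=\{a_i-a_j: 1\le i,j\le k\}\subseteq\mathbb{Z}_n$. Assume that (i) $\Gamma=\mathrm{Cay}(D_{2n},S)$ is normal, and (ii) $\gcd(n,\ a_i-a_j : 1\le i<j\le k)=1$. Then $\mathrm{Aut}(\Gamma)=R(D_{2n})\rtimes H$, where $H$ is (isomorphic to) a subgroup of $(U_0,\times)$, with $U_0:=\{u\in(\mathbb{Z}_n)^\times: u\Delta=\Delta\}$ and $\times$ multiplication modulo $n$.
   Context: $D_{2n}=\langle r,s\mid r^n=e,\ s^2=e,\ srs=r^{-1}\rangle$ is the dihedral group of order $2n$; its reflections are the elements $r^is$, $i\in\mathbb{Z}_n$. For a group $G$ and an inverse-closed subset $S\subseteq G\setminus\{e\}$, the undirected Cayley graph $\mathrm{Cay}(G,S)$ has vertex set $G$, with $u,v$ adjacent if and only if $uv^{-1}\in S$; $\mathrm{Aut}(\mathrm{Cay}(G,S))$ is its graph automorphism group. $R(G)=\{\rho_g: g\in G\}$, $\rho_g(x)=xg$, is the right regular representation of $G$; it is a subgroup of $\mathrm{Aut}(\mathrm{Cay}(G,S))$. The graph $\mathrm{Cay}(G,S)$ is called normal if $R(G)$ is a normal subgroup of $\mathrm{Aut}(\mathrm{Cay}(G,S))$. The gcd is computed with integer representatives. $u\Delta=\{u\delta:\delta\in\Delta\}$.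 The equality $\mathrm{Aut}(\Gamma)=R(D_{2n})\rtimes H$ means that the normal subgroup $R(D_{2n})$ has a complement in $\mathrm{Aut}(\Gamma)$ which is isomorphic to the stated group $H\le U_0$. *)

(* Defs.v *)
From HB Require Import structures.
From mathcomp Require Export all_boot all_order all_fingroup all_algebra all_solvable.

Set Implicit Arguments.
Unset Strict Implicit.
Unset Printing Implicit Defensive.

Import GroupScope.
Local Open Scope group_scope.

Section GraphAut.
Variables (T : finType) (e : rel T).

Definition graph_aut : {set {perm T}} :=
  [set f : {perm T} | [forall x, forall y, e (f x) (f y) == e x y]].

Lemma graph_autP (f : {perm T}) :
  reflect (forall x y, e (f x) (f y) = e x y) (f \in graph_aut).
Proof.
rewrite inE; apply: (iffP forallP) => [ef x y | ef x].
  by have /forallP/(_ y)/eqP := ef x.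
by apply/forallP=> y; rewrite ef.
Qed.

Lemma graph_aut_group_set : group_set graph_aut.
Proof.
apply/group_setP; split=> [|f g /graph_autP ef /graph_autP eg].
  by apply/graph_autP=> x y; rewrite !perm1.
by apply/graph_autP=> x y; rewrite !permM eg ef.
Qed.
Canonical graph_aut_group := Group graph_aut_group_set.

End GraphAut.

Section Cayley.
Variable gT : finGroupType.

(* This relation is the adjacency of a simple undirected graph when S is      *)
(* inverse-closed and 1 \notin S; both hold for any set of reflections.       *)
Definition cay (S : {set gT}) : rel gT := [rel u v | u * v^-1 \in S].

Definition right_regular : {set {perm gT}} := actperm 'R @* [set: gT].
Canonical right_regular_group := [group of right_regular].

Definition cay_normal (S : {set gT}) : bool :=
  right_regular <| graph_aut (cay S).

End Cayley.

(* For n > 1, 'D_(n.*2) has order 2n, so any such pair is the image of the    *)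
(* distinguished generators of <r, s | r^n = s^2 = 1, srs = r^-1> under an    *)
(* isomorphism from that group onto 'D_(n.*2).                                *)
Definition dihedral_generators (n : nat) (r s : 'D_(n.*2)) : Prop :=
  [/\ <<[set r; s]>> = [set: 'D_(n.*2)],
      r ^+ n = 1, s ^+ 2 = 1 & s * r * s = r^-1].

Section Differences.
Variables (n k : nat) (a : 'I_k -> 'Z_n).

Definition diff_set : {set 'Z_n} :=
  [set (a p.1 - a p.2)%R | p : 'I_k * 'I_k].

(* Each difference is read through its representative in [0, n); the gcd does *)
(* not depend on this choice because n is one of its arguments.               *)
Definition diff_gcd : nat :=
  gcdn n (\big[gcdn/0%N]_(i < k) \big[gcdn/0%N]_(j < k | i < j)
            ((a i - a j)%R : 'Z_n)).

End Differences.

Section UnitStabilizer.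
Variables (n : nat) (D : {set 'Z_n}).

Definition unit_stab : {set {unit 'Z_n}} :=
  [set u : {unit 'Z_n} | [set (val u * d)%R | d in D] == D].

Lemma unit_stab_group_set : group_set unit_stab.
Proof.
apply/group_setP; split=> [|u v].
  rewrite inE; apply/eqP; rewrite -[RHS]imset_id.
  by apply: eq_imset => d; rewrite /= GRing.mul1r.
rewrite !inE => /eqP uD /eqP vD; apply/eqP; rewrite -[RHS]uD -[in RHS]vD.
by rewrite -imset_comp; apply: eq_imset => d; rewrite /= -GRing.mulrA.
Qed.
Canonical unit_stab_group := Group unit_stab_group_set.

End UnitStabilizer.

(* Main.v *)
Require Import Defs.
Import GroupScope.
Local Open Scope group_scope.

Set Implicit Arguments.
Unset Strict Implicit.

(** Let A be the automorphism group of the Cayley graph and C the stabilizer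
    of 1 in A. The right translations act regularly on the vertices, so C is a
    complement to R(G) in A (right_regular_sdprod). Since C normalizes R(G) and
    fixes 1, every f in C is an automorphism of the group itself
    (stabilizer_autM), and it maps S to itself because S is the set of
    neighbours of 1.

    For n > 2 an automorphism of the dihedral group maps r to a rotation,
    because r has order n while the elements outside <r> are involutions. Hence
    f r = r ^+ u for some u, its multiplier, and u is a unit modulo n that
    depends multiplicatively on f. Writing f s = r ^+ b * s, the map f induces
    the affine permutation x |-> u x + b of the exponents a i of S. Taking
    differences gives u Delta = Delta (unit_multiplier_diff_set). If u = 1 then
    the translation by b permutes the k exponents; summing them gives k b = 0,
    and b = 0 as k is prime to n (translation_stable_eq0). So f fixes r and s
    and is the identity: the multiplier embeds C into the group U_0
    (unit_multiplier_inj). *)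

(** * Normalizing the right regular representation *)

Section RegularSubgroup.

Variables (gT : finGroupType) (A : {group {perm gT}}).

Lemma right_regularP (f : {perm gT}) :
  reflect (exists g, forall x, f x = x * g) (f \in right_regular gT).
Proof.
apply: (iffP morphimP) => [[g _ _ ->] | [g fE]].
  by exists g => x; rewrite actpermE.
by exists g; rewrite ?inE //; apply/permP => x; rewrite actpermE fE.
Qed.

(** This is the Frattini argument for a regular normal subgroup: regularity
    gives both the trivial intersection and the factorization. *)
Lemma right_regular_sdprod :
  right_regular gT <| A -> right_regular gT ><| 'C_A[1 | 'P] = A.
Proof.
move=> nRA; apply/(sdprod_normal_complP nRA)/complP; split.
  apply/trivgP/subsetP => f /setIP[/setIP[_ /astab1P] + /right_regularP[g fE]].
  rewrite /= apermE fE mul1g => g1.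
  by rewrite inE; apply/eqP/permP => x; rewrite fE g1 mulg1 perm1.
apply/eqP; rewrite eqEsubset mulG_subG subsetIl normal_sub //=.
apply/subsetP => f Af.
(* Correct f by the translation that brings f 1 back to 1. *)
have Rg : actperm 'R (f 1) \in right_regular gT by rewrite mem_morphim ?inE.
have ARg := subsetP (normal_sub nRA) _ Rg.
rewrite -(mulgKV (actperm 'R (f 1)) f) mem_mulg // inE groupM ?groupV //=.
apply/astab1P; rewrite /= apermE permM; apply: (@perm_inj _ (actperm 'R (f 1))).
by rewrite permKV actpermE /= mul1g.
Qed.

(** Conjugating the translation by g with f gives a translation by some h;
    evaluating it at the fixed point 1 identifies h as f g, and the conjugation
    relation then reads f (x * g) = f x * f g. *)
Lemma stabilizer_autM (f : {perm gT}) :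
    right_regular gT <| A -> f \in 'C_A[1 | 'P] ->
  {morph f : x y / x * y}.
Proof.
move=> nRA /setIP[Af /astab1P]; rewrite /= apermE => f1 x g.
have Rg : actperm 'R g \in right_regular gT by rewrite mem_morphim ?inE.
have: actperm 'R g ^ f \in right_regular gT.
  by rewrite memJ_norm // (subsetP (normal_norm nRA)).
case/right_regularP=> h hE.
have fR y : f (y * g) = f y * h.
  by rewrite -hE conjgE !permM permK actpermE.
by rewrite fR; congr (_ * _); rewrite -[LHS]mul1g -f1 -fR mul1g.
Qed.

End RegularSubgroup.

(** * Translations and powers indexed by integers modulo n *)

(** Translation by b permutes T, so the sum of T equals itself plus #|T| b. *)
Lemma translation_stable_eq0 (n : nat) (T : {set 'Z_n}) (b : 'Z_n) :
    (1 < n)%N -> coprime n #|T| -> (forall x, x \in T -> (x + b)%R \in T) ->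
  b = 0%R.
Proof.
move=> n_gt1 co_nT Tb.
have addI : injective (fun x : 'Z_n => (x + b)%R) by apply: GRing.addIr.
have TbE : [set (x + b)%R | x in T] = T.
  apply/eqP; rewrite eqEcard card_imset // leqnn andbT.
  by apply/subsetP => _ /imsetP[x /Tb Txb ->].
have : (\sum_(x in T) x = \sum_(x in T) x + b *+ #|T|)%R.
  rewrite -{1}TbE big_imset /=; last by move=> x y _ _; apply: addI.
  by rewrite big_split /= GRing.sumr_const.
rewrite -{1}[(\sum_(x in T) x)%R]GRing.addr0 => /GRing.addrI/esym.
rewrite -GRing.mulr_natr => b0.
have uT : ((#|T|%:R : 'Z_n) \is a GRing.unit)%R by rewrite unitZpE.
by apply: (GRing.mulIr uT); rewrite b0 GRing.mul0r.
Qed.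

Section ZnPowers.

Variables (gT : finGroupType) (r : gT) (n : nat).
Hypotheses (n_gt1 : (1 < n)%N) (r_n : r ^+ n = 1).

Let r_Zn : r ^+ (Zp_trunc n).+2 = 1. Proof. by rewrite Zp_cast. Qed.

Lemma expg_ZpD (x y : 'Z_n) : r ^+ (x + y)%R = r ^+ x * r ^+ y.
Proof. by rewrite /= expg_mod // expgD. Qed.

Lemma expg_ZpM (x y : 'Z_n) : r ^+ (x * y)%R = r ^+ x ^+ y.
Proof. by rewrite /= expg_mod // expgM. Qed.

Lemma expg_Zp1 : r ^+ (1%R : 'Z_n) = r.
Proof. by rewrite /= modn_small. Qed.

Lemma expg_Zp_nat (i : nat) : r ^+ (i%:R%R : 'Z_n) = r ^+ i.
Proof. by rewrite val_Zp_nat // expg_mod. Qed.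

Lemma expg_Zp_inj (x y : 'Z_n) : #[r] = n -> r ^+ x = r ^+ y -> x = y.
Proof.
move=> or /eqP; rewrite eq_expg_mod_order or.
have Zlt (z : 'Z_n) : (z < n)%N by rewrite -[ltnRHS]Zp_cast // ltn_ord.
by rewrite !modn_small // => /eqP/val_inj.
Qed.

End ZnPowers.

(** * Automorphisms of the dihedral group *)

Section Dihedral.

Variables (gT : finGroupType) (n : nat) (r s : gT).
Hypotheses (n_gt2 : (2 < n)%N) (cardG : #|[set: gT]| = n.*2).
Hypotheses (genG : <<[set r; s]>> = [set: gT]).
Hypotheses (r_n : r ^+ n = 1) (s_2 : s ^+ 2 = 1) (srs : s * r * s = r^-1).

Let n_gt1 : (1 < n)%N := ltnW n_gt2.

Let s_inv : s^-1 = s.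
Proof. by apply/eqP; rewrite eq_invg_mul; apply/eqP. Qed.

Lemma dihedral_mul_cycles : <[r]> * <[s]> = [set: gT].
Proof.
rewrite -norm_joinEr; first by rewrite joing_idl joing_idr.
by rewrite cycle_subG inE /= -cycleJ conjgE s_inv mulgA srs cycleV.
Qed.

(** The product of <r> and <s> has at most #[r] * 2 elements, and it must have
    2n, while r ^+ n = 1 bounds #[r] by n. *)
Lemma dihedral_order : #[r] = n.
Proof.
have r_le : (#[r] <= n)%N by rewrite dvdn_leq ?(ltnW n_gt1) ?order_dvdn ?r_n.
have s_le : (#[s] <= 2)%N by rewrite dvdn_leq ?order_dvdn ?s_2.
apply/eqP; rewrite eqn_leq r_le -leq_double -cardG.
have /= := mul_cardG <[r]> <[s]>.
rewrite dihedral_mul_cycles cardG => rsE.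
apply: leq_trans (leq_pmulr _ (cardG_gt0 (<[r]> :&: <[s]>))) _.
by rewrite -rsE -muln2 leq_mul.
Qed.

Lemma dihedral_cycle_s (x : gT) : x \in <[s]> -> x = 1 \/ x = s.
Proof.
case/cycleP=> i ->; rewrite -(odd_double_half i) expgD -mul2n expgM s_2 expg1n.
by rewrite mulg1; case: (odd i); [right | left].
Qed.

Lemma dihedral_reflection_sqr (x : gT) : x \notin <[r]> -> x ^+ 2 = 1.
Proof.
have: x \in <[r]> * <[s]> by rewrite dihedral_mul_cycles inE.
case/mulsgP=> _ y /cycleP[i ->] /dihedral_cycle_s[->|->] ->.
  by rewrite mulg1 mem_cycle.
have ris : s * r ^+ i * s = r ^- i.
  by rewrite -{1}s_inv -mulgA -conjgE conjXg conjgE s_inv mulgA srs expgVn.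
by move=> _; rewrite expgS expg1 -mulgA (mulgA s) ris mulgV.
Qed.

Section Stabilizer.

Variable A : {group {perm gT}}.
Hypothesis nRA : right_regular gT <| A.

Let C := 'C_A[1 | 'P]%G.

Let fM (f : {perm gT}) : f \in C -> {morph f : x y / x * y}.
Proof. exact: stabilizer_autM. Qed.

Let f1 (f : {perm gT}) : f \in C -> f 1 = 1.
Proof. by case/setIP=> _ /astab1P. Qed.

Let fX (f : {perm gT}) x i : f \in C -> f (x ^+ i) = f x ^+ i.
Proof.
by move=> Cf; elim: i => [|i IHi]; rewrite ?f1 // !expgS fM ?IHi.
Qed.

(** Otherwise f r is an involution, so r ^+ 2 = 1 by injectivity of f, against
    #[r] = n > 2. *)
Lemma stabilizer_rotation (f : {perm gT}) : f \in C -> f r \in <[r]>.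
Proof.
move=> Cf; apply: contraLR n_gt2 => /dihedral_reflection_sqr.
rewrite -fX // -[in RHS](f1 Cf) => /perm_inj/eqP.
by rewrite -order_dvdn dihedral_order -leqNgt; apply: dvdn_leq.
Qed.

(** Defined on all permutations so that it can be a function; only its values
    on C are meaningful, and the default 0 is never reached there. *)
Definition multiplier (f : {perm gT}) : 'Z_n :=
  odflt 0%R [pick x : 'Z_n | f r == r ^+ x].

Lemma multiplierP (f : {perm gT}) : f \in C -> f r = r ^+ multiplier f.
Proof.
move=> Cf; rewrite /multiplier; case: pickP => [x /eqP // | /= noX].
have /cycleP[i fr] := stabilizer_rotation Cf.
by have /eqP[] := noX i%:R%R; rewrite fr expg_Zp_nat.
Qed.

Lemma multiplier_expg (f : {perm gT}) (x : 'Z_n) :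
  f \in C -> f (r ^+ x) = r ^+ (multiplier f * x)%R.
Proof. by move=> Cf; rewrite fX // multiplierP // expg_ZpM. Qed.

Lemma multiplierM :
  {in C &, {morph multiplier : f g / f * g >-> (f * g)%R}}.
Proof.
move=> f g Cf Cg; apply: (expg_Zp_inj n_gt1 dihedral_order).
rewrite -multiplierP ?groupM // permM multiplierP //.
by rewrite multiplier_expg // GRing.mulrC.
Qed.

Lemma multiplier1 : multiplier 1 = 1%R.
Proof.
apply: (expg_Zp_inj n_gt1 dihedral_order).
by rewrite -multiplierP // perm1 expg_Zp1.
Qed.

(** The multiplier of f^-1 is the inverse of that of f. *)
Lemma multiplier_unit (f : {perm gT}) :
  f \in C -> (multiplier f \is a GRing.unit)%R.
Proof.
move=> Cf; apply/GRing.unitrPr; exists (multiplier f^-1).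
by rewrite -multiplierM ?groupV // mulgV multiplier1.
Qed.

Definition unit_multiplier (f : {perm gT}) : {unit 'Z_n} :=
  insubd (1 : {unit 'Z_n}) (multiplier f).

Lemma val_unit_multiplier (f : {perm gT}) :
  f \in C -> val (unit_multiplier f) = multiplier f.
Proof. by move=> Cf; rewrite insubdK //; apply: multiplier_unit. Qed.

Lemma unit_multiplierM : {in C &, {morph unit_multiplier : f g / f * g}}.
Proof.
move=> f g Cf Cg; apply: val_inj.
by rewrite FinRing.val_unitM !val_unit_multiplier ?groupM // multiplierM.
Qed.
Canonical unit_multiplier_morphism := Morphism unit_multiplierM.

Section ReflectionSet.

Variables (k : nat) (a : 'I_k -> 'Z_n).
Hypotheses (k_gt0 : (0 < k)%N) (co_nk : coprime n k) (a_inj : injective a).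
Hypothesis (stabS : forall (f : {perm gT}) i, f \in C ->
  exists j, f (r ^+ a i * s) = r ^+ a j * s).

(** r ^+ (a i - a j) is the quotient of two elements of S, so f maps it to
    another such quotient: multiplication by u sends Delta into itself, hence
    onto itself since it is injective and Delta is finite. *)
Lemma unit_multiplier_diff_set :
  unit_multiplier @* C \subset unit_stab (diff_set a).
Proof.
apply/subsetP=> _ /morphimP[f _ Cf ->]; rewrite inE /=.
rewrite val_unit_multiplier //.
have mI : injective (fun d => multiplier f * d)%R.
  by apply: GRing.mulrI; apply: multiplier_unit.
rewrite eqEcard (card_imset _ mI) leqnn andbT.
apply/subsetP=> _ /imsetP[_ /imsetP[[i j] _ ->] ->] /=.
have [i' fi] := stabS i Cf; have [j' fj] := stabS j Cf.
apply/imsetP; exists (i', j'); rewrite //=.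
apply: (expg_Zp_inj n_gt1 dihedral_order).
(* Multiplying by f (r ^+ a j * s) makes both sides equal to f (r ^+ a i * s). *)
apply: (mulIg (r ^+ a j' * s)).
rewrite [RHS]mulgA -(expg_ZpD n_gt1 r_n) GRing.subrK -fi -fj.
rewrite -multiplier_expg // -fM // mulgA -(expg_ZpD n_gt1 r_n).
by rewrite GRing.subrK.
Qed.

(** An f with multiplier 1 fixes the rotations and shifts all the exponents of
    S by the same b; that shift is 0 because #|S| is prime to n. *)
Lemma unit_multiplier_inj : 'injm unit_multiplier.
Proof.
apply/subsetP=> f /morphpreP[Cf /set1P fE].
have m1 : multiplier f = 1%R by rewrite -val_unit_multiplier // fE.
have fr x : f (r ^+ (x : 'Z_n)) = r ^+ x.
  by rewrite multiplier_expg // m1 GRing.mul1r.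
pose i0 := Ordinal k_gt0; have [j0 fi0] := stabS i0 Cf.
pose b := (a j0 - a i0)%R.
have fs : f s = r ^+ b * s.
  apply: (mulgI (r ^+ a i0)); rewrite -{1}fr -fM // fi0 mulgA -expg_ZpD //.
  by rewrite GRing.subrKC.
have b0 : b = 0%R.
  apply: (@translation_stable_eq0 n [set a i | i : 'I_k]) => //.
    by rewrite card_imset // card_ord.
  move=> _ /imsetP[i _ ->]; have [j fi] := stabS i Cf.
  apply/imsetP; exists j => //; apply: (expg_Zp_inj n_gt1 dihedral_order).
  by apply: (mulIg s); rewrite -fi fM // fr fs mulgA expg_ZpD.
have {}fs : f s = s by rewrite fs b0 mul1g.
rewrite inE; apply/eqP/permP=> x; rewrite perm1.
have: x \in <[r]> * <[s]> by rewrite dihedral_mul_cycles inE.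
case/mulsgP=> _ _ /cycleP[i ->] /cycleP[j ->] ->.
have fr1 : f r = r by have := fr 1%R; rewrite expg_Zp1.
by rewrite fM // !fX // fs fr1.
Qed.

End ReflectionSet.

End Stabilizer.

End Dihedral.

(** * The Cayley graph *)

(** S is the set of neighbours of the fixed vertex 1. *)
Lemma cay_stabilizer_mem (gT : finGroupType) (S : {set gT}) (f : {perm gT}) x :
  f \in 'C_(graph_aut (cay S))[1 | 'P] -> (f x \in S) = (x \in S).
Proof.
case/setIP=> /graph_autP/(_ x 1) + /astab1P/=; rewrite apermE => + f1.
by rewrite f1 /cay /= !invg1 !mulg1.
Qed.

Theorem theorem4p8 (n k : nat) (k_ge4 : (4 <= k)%N) (k_lt_n : (k < n)%N)
    (co_nk : gcdn n k = 1%N)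
    (r s : 'D_(n.*2)) (rs_gen : dihedral_generators r s)
    (a : 'I_k -> 'Z_n)
    (refl_distinct : injective (fun i : 'I_k => r ^+ a i * s))
    (S : {set 'D_(n.*2)}) (defS : S = [set r ^+ a i * s | i : 'I_k])
    (S_normal : cay_normal S)
    (gcd_diff : diff_gcd a = 1%N) :
  exists (C : {group {perm 'D_(n.*2)}}) (H : {group {unit 'Z_n}}),
    [/\ H \subset unit_stab (diff_set a),
        right_regular _ ><| C = graph_aut (cay S)
      & C \isog H].
Proof.
have n_gt2 : (2 < n)%N := ltn_trans (ltnW k_ge4) k_lt_n.
have k_gt0 : (0 < k)%N := ltn_trans (isT : 0 < 3)%N k_ge4.
have cardD : #|[set: 'D_(n.*2)]| = n.*2 by rewrite card_dihedral // ltnW.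
have [genD r_n s_2 srs] := rs_gen.
have a_inj : injective a by move=> i j aij; apply: refl_distinct; rewrite aij.
pose C := 'C_(graph_aut (cay S))[1 | 'P]%G.
have stabS (f : {perm 'D_(n.*2)}) i :
    f \in C -> exists j, f (r ^+ a i * s) = r ^+ a j * s.
  move=> Cf; have: f (r ^+ a i * s) \in S.
    by rewrite cay_stabilizer_mem // defS; apply/imsetP; exists i.
  by rewrite defS => /imsetP[j _ ->]; exists j.
pose phi := unit_multiplier_morphism n_gt2 cardD genD r_n s_2 srs S_normal.
exists C, (phi @* C)%G; split.
- exact: unit_multiplier_diff_set.
- exact: right_regular_sdprod.
- have co_nkb : coprime n k by apply/eqP.
  by rewrite sub_isog //; exact: unit_multiplier_inj k_gt0 co_nkb a_inj stabS.
Qed.
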